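(* Let $a\ge1$ be an integer and let $\alpha=a+\frac1{a+}\,\frac1{a+}\,\frac1{a+}\cdots=\frac12\left(a+\sqrt{a^2+4}\right)$. Let $p_m/q_m$ denote the regular continued fraction convergents of $\alpha$. Then for each sufficiently large positive integer $m$ there exists a $p\in(0,1)$ such that the initial $p$-convergent $r_0/s_0$ of $\alpha$ satisfies $r_0/s_0=p_m/q_m$.
   Context: Regular convergents: with all partial quotients $b_n=a$, $p_n=b_np_{n-1}+p_{n-2}$, $q_n=b_nq_{n-1}+q_{n-2}$ for $n\ge0$, with $p_{-2}=0,p_{-1}=1,q_{-2}=1,q_{-1}=0$. $p$-convergents (the convergents of the $p$-continued fraction): for $p\in(0,1)$, $F^{\langle p\rangle}(x,y)=(|x|^p+|y|^p)^{1/p}$, and for $t>0$, $F_t^{\langle p\rangle}(x,y)=F^{\langle p\rangle}(t^{-1}x,ty)$. For $P\in\mathbb{R}^2$ put $\mathcal{B}_t(P)=\{P'\in\mathbb{R}^2: F_t^{\langle p\rangle}(P')<F_t^{\langle p\rangle}(P)\}$. A lattice is admissible for a set $S$ if the only lattice point inside $S$ is the origin. Let $L_\alpha=(0,1)\mathbb{Z}+(1,-\alpha)\mathbb{Z}$. Set $P_{-1}=(0,1)$, $t_{-1}=1$. Given $P_m$ and $t_m$ ($m\ge -1$), let $t_{m+1}$ be the largest $T\geq t_m$ such that $L_\alpha$ is admissible for $\mathcal{B}_t(P_m)$ for all $t\in[t_m,T]$, and let $P_{m+1}$ be the (unique) point of $L_\alpha$ with maximal $x$-coordinate among the finitely many $P'\in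 L_\alpha$ with $F^{\langle p\rangle}_{t_{m+1}}(P')=F^{\langle p\rangle}_{t_{m+1}}(P_m)$. Write $P_m=(x_m,y_m)$, $s_m=x_m$ and $r_m=y_m+x_m\alpha\in\mathbb{Z}$ for $m\ge0$. The $p$-convergents are $r_m/s_m$, $m\ge0$. *)

(* Defs.v *)
From HB Require Import structures.
From mathcomp Require Import all_boot all_order all_algebra.
From mathcomp Require Import all_classical all_reals all_analysis.
From mathcomp Require Import ring lra.

Set Implicit Arguments.
Unset Strict Implicit.
Unset Printing Implicit Defensive.

Import Order.TTheory GRing.Theory Num.Theory.
Import numFieldNormedType.Exports.

Local Open Scope classical_set_scope.
Local Open Scope ring_scope.

(* The pair (w_{n-2}, w_{n-1}) of the recurrence w_n = b_n w_{n-1} + w_{n-2},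
   n >= 0, started at w_{-2} = u, w_{-1} = v. *)
Fixpoint cf_rec (b : nat -> nat) (u v n : nat) : nat * nat :=
  if n is k.+1 then
    let w := cf_rec b u v k in (w.2, (b k * w.2 + w.1)%N)
  else (u, v).

Definition cf_num (b : nat -> nat) (n : nat) : nat := (cf_rec b 0 1 n.+1).2.
Definition cf_den (b : nat -> nat) (n : nat) : nat := (cf_rec b 1 0 n.+1).2.

Section PContinuedFraction.
Variable R : realType.
Implicit Types (p alpha t T : R) (P Q : R * R) (E S L : set (R * R)).

Definition metallic_mean (a : nat) : R := (a%:R + Num.sqrt (a%:R ^+ 2 + 4)) / 2.

(* powR sends 0 to 0 for a nonzero exponent, so F is right on the axes. *)
Definition F p P : R := (`|P.1| `^ p + `|P.2| `^ p) `^ p^-1.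

Definition Ft p t P : R := F p (t^-1 * P.1, t * P.2).

Definition Bt p t P : set (R * R) := [set Q | Ft p t Q < Ft p t P].

Definition lattice alpha : set (R * R) :=
  [set P | exists m n : int, P = (0, 1) *~ m + (1, - alpha) *~ n].

Definition admissible L S : Prop := L `&` S = [set 0].

Definition is_largest (A : set R) T : Prop := A T /\ forall T', A T' -> T' <= T.

(* The strict inequality makes the rightmost point unique. *)
Definition is_rightmost E P : Prop :=
  E P /\ forall Q, E Q -> Q <> P -> Q.1 < P.1.

Definition adm_times p alpha P t : set R :=
  [set T | t <= T /\
    forall u, t <= u <= T -> admissible (lattice alpha) (Bt p u P)].

Definition level_points p alpha P t : set (R * R) :=
  [set Q | lattice alpha Q /\ Ft p t Q = Ft p t P].

(* xget 0 picks the element satisfying the predicate (here there is at most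
   one), and is 0 when there is none.  If either choice fails at step m, then the
   m-th point is 0 and the ratio r_m / s_m is 0. *)
Definition next_t p alpha P t : R := xget 0 (is_largest (adm_times p alpha P t)).

Definition next_P p alpha P T : R * R :=
  xget 0 (is_rightmost (level_points p alpha P T)).

(* Index shifted by one: pcf_state p alpha n is (P_{n-1}, t_{n-1}). *)
Fixpoint pcf_state p alpha (n : nat) : (R * R) * R :=
  if n is k.+1 then
    let: (P, t) := pcf_state p alpha k in
    let t' := next_t p alpha P t in (next_P p alpha P t', t')
  else ((0, 1), 1).

Definition pcf_point p alpha (m : nat) : R * R := (pcf_state p alpha m.+1).1.

Definition pcf_s p alpha m : R := (pcf_point p alpha m).1.
Definition pcf_r p alpha m : R :=
  (pcf_point p alpha m).2 + (pcf_point p alpha m).1 * alpha.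

Definition p_convergent p alpha m : R := pcf_r p alpha m / pcf_s p alpha m.

Definition convergent (b : nat -> nat) (n : nat) : R :=
  (cf_num b n)%:R / (cf_den b n)%:R.

Lemma metallic_mean_gt1 (a : nat) : (0 < a)%N -> 1 < metallic_mean a.
Proof.
move=> a0; have a1 : 1 <= a%:R :> R by rewrite ler1n.
have s0 : 0 <= Num.sqrt (a%:R ^+ 2 + 4) :> R by exact: sqrtr_ge0.
have s2 : Num.sqrt (a%:R ^+ 2 + 4) ^+ 2 = a%:R ^+ 2 + 4 :> R.
  by rewrite sqr_sqrtr // addr_ge0 // sqr_ge0.
rewrite /metallic_mean; nra.
Qed.

Lemma metallic_mean_sqr (a : nat) : metallic_mean a ^+ 2 = a%:R * metallic_mean a + 1.
Proof.
have s2 : Num.sqrt (a%:R ^+ 2 + 4) ^+ 2 = a%:R ^+ 2 + 4 :> R.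
  by rewrite sqr_sqrtr // addr_ge0 // sqr_ge0.
by rewrite /metallic_mean; field: s2.
Qed.

Lemma metallic_mean_error (a n : nat) : (0 < a)%N ->
  (cf_den (fun=> a) n)%:R * metallic_mean a - (cf_num (fun=> a) n)%:R =
  - (- (metallic_mean a)^-1) ^+ n.+1.
Proof.
move=> a0; have m0 : metallic_mean a != 0 by have := metallic_mean_gt1 a0; lra.
have m2 := metallic_mean_sqr a.
pose e k := (cf_rec (fun=> a) 1 0 k).2%:R * metallic_mean a
            - (cf_rec (fun=> a) 0 1 k).2%:R : R.
pose d k := (cf_rec (fun=> a) 1 0 k).1%:R * metallic_mean a
            - (cf_rec (fun=> a) 0 1 k).1%:R : R.
have mV : (metallic_mean a)^-1 = metallic_mean a - a%:R.
  apply: (mulfI m0); rewrite divff // mulrBr -expr2 m2; ring.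
suff H k : e k = - (- (metallic_mean a)^-1) ^+ k /\
           d k = metallic_mean a * (- (metallic_mean a)^-1) ^+ k by have [] := H n.+1.
elim: k => [|k [IHe IHd]]; first by split; rewrite /e /d /= expr0; ring.
split.
  have -> : e k.+1 = a%:R * e k + d k.
    by rewrite /e /d /= !natrD !natrM; ring.
  by rewrite IHe IHd exprSr mV; ring.
have -> : d k.+1 = e k by [].
by rewrite IHe exprS mulrA mulrN divff // mulN1r.
Qed.

Lemma convergent_metallic_mean (a : nat) : (0 < a)%N ->
  convergent (fun=> a) n @[n --> \oo] --> metallic_mean a.
Proof.
move=> a0; have m1 := metallic_mean_gt1 a0; have m0 : 0 < metallic_mean a by lra.
have den1 n : (0 < cf_den (fun=> a) n)%N.
  suff H k : (0 < (cf_rec (fun=> a) 1 0 k.+1).2)%N /\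
             (0 <= (cf_rec (fun=> a) 1 0 k.+1).1)%N by have [] := H n.
  elim: k => [|k [IH _]]; first by rewrite /= muln0.
  by split=> //; rewrite [X in (_ < X)%N]/= addn_gt0 muln_gt0 a0 IH.
have g0 : (metallic_mean a)^-1 ^+ n.+1 @[n --> \oo] --> (0 : R).
  rewrite (cvg_shiftS (fun n => (metallic_mean a)^-1 ^+ n)).
  by apply: cvg_expr; rewrite ger0_norm ?invr_ge0 ?ltW // invf_lt1.
apply/cvgrPdist_le => eps eps0.
have /cvgrPdist_le/(_ _ eps0) := g0.
apply: filterS => n; apply: le_trans.
have q1 : 1 <= (cf_den (fun=> a) n)%:R :> R by rewrite ler1n.
have q0 : (cf_den (fun=> a) n)%:R != 0 :> R by rewrite gt_eqF // (lt_le_trans _ q1).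
have -> : metallic_mean a - convergent (fun=> a) n =
    ((cf_den (fun=> a) n)%:R * metallic_mean a - (cf_num (fun=> a) n)%:R)
     / (cf_den (fun=> a) n)%:R.
  by rewrite /convergent; field.
rewrite metallic_mean_error // normrM normrN normrX normrN sub0r normrN normrX.
by rewrite ler_piMr ?exprn_ge0 // normfV invf_le1 ?normr_gt0 // ger0_norm ?ler0n.
Qed.

End PContinuedFraction.

(* Main.v *)
(* The first point of the p-continued fraction minimizes q^p / (1 - |y|^p) over
   the lattice points (q, y) = (q, r - q alpha) with q > 0, and by best
   approximation the minimum is attained at a convergent.  For the metallic
   mean, q_n is nearly x / (alpha + 1/alpha) and |y_n| = 1/x, x = alpha^(n+1),
   so with u = x^p the quantity to minimize is proportional to u^2 / (u - 1), up
   to an error exponentially small in n.  Its minimum is at u = 2; hence p is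
   chosen so that alpha^((m+1) p) = 2.  The values at other powers of alpha^p
   exceed the minimum by a relative amount of order 1/m^2, which absorbs the
   error. *)

Require Import Defs.
From mathcomp Require Import all_boot all_order all_algebra.
From mathcomp Require Import all_classical all_reals all_analysis.
From mathcomp Require Import ring lra zify.

Import Order.TTheory GRing.Theory Num.Theory.
Local Open Scope ring_scope.

(** * Elementary estimates for powers and exponentials *)

Lemma bernoulli_ge {R : realType} (n : nat) (x : R) :
  -1 <= x -> 1 + n%:R * x <= (1 + x) ^+ n.
Proof.
move=> x1; elim: n => [|n IH]; first by rewrite expr0; lra.
rewrite exprS -addn1 natrD.
have n0 : 0 <= n%:R :> R by [].
have h : (1 + x) * (1 + n%:R * x) <= (1 + x) * (1 + x) ^+ n.
  by apply: ler_wpM2l => //; lra.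
have h2 : 0 <= n%:R * x ^+ 2 by rewrite mulr_ge0 // sqr_ge0.
by apply: le_trans h; lra.
Qed.

Lemma powR_inv_base {R : realType} (x p : R) : 0 < x -> x^-1 `^ p = (x `^ p)^-1.
Proof.
move=> x0; have xp : 0 < x `^ p by exact: powR_gt0.
apply: (mulfI (lt0r_neq0 xp)).
by rewrite -powRM ?invr_ge0 ?(ltW x0) // !divff ?powR1 ?lt0r_neq0.
Qed.

Lemma powR_ge1 {R : realType} (x p : R) : 0 <= p -> 1 <= x -> 1 <= x `^ p.
Proof. by move=> p0 x1; rewrite -[leLHS](powRr0 x) ler_powR. Qed.

(** The cubic Taylor term [(n * ln alpha) ^+ 3 / 6] of [expR (n * ln alpha)] already outgrows a
    multiple of [n ^+ 2]. *)
Lemma cubic_exp_bound {R : realType} (alpha C : R) (n : nat) : 1 < alpha ->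
  C * 6 / ln alpha ^+ 3 < n%:R -> C * n%:R ^+ 2 < alpha ^+ n.
Proof.
move=> a1; have l0 : 0 < ln alpha by exact: ln_gt0.
rewrite ltr_pdivrMr ?exprn_gt0 // => h.
have -> : alpha ^+ n = expR (ln alpha * n%:R).
  by rewrite mulrC expRM_natl lnK // posrE; lra.
apply: lt_le_trans (@expR_ge1Dxn R _ 2 _); last by rewrite mulr_ge0 // ltW.
have -> : (3`!%N)%:R = 6 :> R by [].
rewrite exprMn.
have : C * 6 * n%:R ^+ 2 <= n%:R * ln alpha ^+ 3 * n%:R ^+ 2.
  by apply: ler_wpM2r; rewrite ?sqr_ge0 // ltW.
by lra.
Qed.

(** * Gap estimates around the N-th root of 2 *)

Lemma root2_sub1_ub {R : realType} (b : R) (N : nat) :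
  1 < b -> (0 < N)%N -> b ^+ N = 2 -> b - 1 <= N%:R^-1.
Proof.
move=> b1 N0 bN; have Np : 0 < N%:R :> R by rewrite ltr0n.
have b1' : -1 <= b - 1 by lra.
have := bernoulli_ge N _ b1'.
rewrite [1 + (b - 1)]addrC subrK bN => h.
rewrite -[X in _ <= X]div1r ler_pdivlMr //.
lra.
Qed.

(** Bernoulli's inequality for [b^-1], whose N-th power is 1/2. *)
Lemma root2_sub1_lb {R : realType} (b : R) (N : nat) :
  1 < b -> (0 < N)%N -> b ^+ N = 2 -> (2 * N%:R)^-1 <= 1 - b^-1.
Proof.
move=> b1 N0 bN; have Np : 0 < N%:R :> R by rewrite ltr0n.
have bV : 0 < b^-1 by rewrite invr_gt0; lra.
have bV1 : -1 <= b^-1 - 1 by lra.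
have := bernoulli_ge N _ bV1.
rewrite [1 + (b^-1 - 1)]addrC subrK exprVn bN => h.
rewrite -[X in X <= _]div1r ler_pdivrMr ?mulr_gt0 //.
lra.
Qed.

(** The powers of [b] nearest to 2 are [2 / b] and [2 * b]. Their distances to 2 are
    [2 * (1 - b^-1)] and the larger [2 * (b - 1)]. *)
Lemma root2_pow_dist {R : realType} (b : R) (N k : nat) :
  1 < b -> (0 < N)%N -> b ^+ N = 2 ->
  k <> N -> N%:R^-1 <= `|b ^+ k - 2|.
Proof.
move=> b1 N0 bN; have Np : 0 < N%:R :> R by rewrite ltr0n.
have h := root2_sub1_lb _ _ b1 N0 bN; rewrite invfM in h.
have b0 : 0 < b by lra.
have NV : 0 < N%:R^-1 :> R by rewrite invr_gt0.
have bV : 0 < b^-1 by rewrite invr_gt0.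
move=> /eqP; rewrite neq_ltn => /orP[kN|Nk].
  have : b ^+ k * b <= 2 by rewrite -exprSr -bN ler_eXn2l.
  rewrite -ler_pdivlMr // => hk.
  rewrite ler0_norm; lra.
have : b * 2 <= b ^+ k by rewrite -bN -exprS ler_eXn2l.
have bbV : b * b^-1 = 1 by rewrite divff // gt_eqF.
have bV1 : b^-1 <= 1 by rewrite invf_le1 // ltW.
have hb : 0 <= (b - 1) * (1 - b^-1) by rewrite mulr_ge0; lra.
move=> hk.
rewrite ger0_norm; lra.
Qed.

(* [u^2 - 4 (u - 1) = (u - 2)^2] with [u = b^k]: the function [u^2 / (u - 1)]
   has its minimum 4 at [u = 2], that is at [k = N]. *)
Lemma root2_pow_gap {R : realType} (b : R) (N k : nat) :
  1 < b -> (0 < N)%N -> b ^+ N = 2 ->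
  (0 < k)%N -> k <> N ->
  (1 + (12 * N%:R ^+ 2)^-1) * (4 * (b ^+ k - 1)) <= (b ^+ k) ^+ 2.
Proof.
move=> b1 N0 bN k0 kN; have := root2_pow_dist _ _ _ b1 N0 bN kN.
 set u := b ^+ k; set e := N%:R^-1 => he.
have u1 : 1 < u by rewrite exprn_egt1 // -lt0n.
have e0 : 0 < e by rewrite invr_gt0 ltr0n.
have e1 : e <= 1 by rewrite invf_le1 ?ltr0n // ler1n.
rewrite invfM -exprVn -/e.
(* With [v = |u - 2|], the bounds [u - 1 <= 1 + v], [e <= v] and [e <= 1] make the left side at most
   [2 * v ^+ 2]. *)
suff : e ^+ 2 * (u - 1) <= 3 * (u - 2) ^+ 2 by lra.
rewrite -(@real_normK R (u - 2)) ?num_real //.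
have : u - 2 <= `|u - 2| by exact: ler_norm.
set v := `|_| in he *; move=> huv.
have h1 : e ^+ 2 <= v ^+ 2 by rewrite lerXn2r ?nnegrE //; lra.
have h2 : e ^+ 2 * v <= v ^+ 2.
  rewrite expr2 -mulrA expr2; apply: ler_pM => //; nra.
have h3 : e ^+ 2 * (u - 1) <= e ^+ 2 * (1 + v).
  by apply: ler_wpM2l; [exact: sqr_ge0|lra].
have := sqr_ge0 v; nra.
Qed.

(* With [2 = alpha^(N p)], the left and right bases are the bounds for
   [(alpha + alpha^-1) q] at the indices N and k. *)
Lemma power_sum_gap {R : realType} (alpha p : R) (N k : nat) :
  1 < alpha -> alpha + 1 <= alpha ^+ 2 -> 0 < p <= 1 ->
  (alpha `^ p) ^+ N = 2 -> (16 <= N)%N -> 36 * N%:R ^+ 2 < alpha ^+ N ->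
  (0 < k)%N -> k <> N ->
  2 * (alpha ^+ N + (alpha ^+ N)^-1) `^ p * (1 - ((alpha ^+ k) `^ p)^-1)
    < (alpha ^+ k - (alpha ^+ k)^-1) `^ p.
Proof.
move=> a1 a2 /andP[p0 p1] bN N16 aN k0 kN.
have a0 : 0 < alpha by lra.
have powX j : (alpha ^+ j) `^ p = (alpha `^ p) ^+ j.
  by rewrite -[alpha ^+ j]powR_mulrn ?(ltW a0) // powRAC powR_mulrn // powR_ge0.
set b := alpha `^ p in bN powX.
have N0 : (0 < N)%N by exact: leq_trans N16.
have b0 : 0 < b by rewrite powR_gt0.
have b1 : 1 < b.
  rewrite ltNge; apply/negP => b1.
  have : b ^+ N <= 1 by rewrite exprn_ile1 // ltW.
  by rewrite bN; lra.
rewrite powX.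
set u := b ^+ k; set eps := (alpha ^+ N)^-1; set z := (alpha ^+ k)^-1 ^+ 2.
have u1 : 1 < u by rewrite exprn_egt1 // -lt0n.
have aNp : 0 < alpha ^+ N by rewrite exprn_gt0.
have akp : 0 < alpha ^+ k by rewrite exprn_gt0.
have eps0 : 0 < eps by rewrite invr_gt0.
have -> : alpha ^+ N + eps = alpha ^+ N * (1 + eps ^+ 2).
  by rewrite /eps; field; rewrite gt_eqF.
have -> : alpha ^+ k - (alpha ^+ k)^-1 = alpha ^+ k * (1 - z).
  by rewrite /z; field; rewrite gt_eqF.
have z0 : 0 < z by rewrite exprn_gt0 // invr_gt0.
have zle j : (j <= k.*2)%N -> z <= (alpha ^+ j)^-1.
  move=> jk; rewrite /z exprVn -exprM lef_pV2 ?posrE ?exprn_gt0 //.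
  by rewrite ler_eXn2l // muln2.
(* Divided by [alpha ^+ 2], the hypothesis [a2] reads [alpha^-1 + alpha^-2 <= 1], and
   [z <= alpha^-2] because [k >= 1]. *)
have aV : alpha^-1 <= 1 - z.
  have k2 : (2 <= k.*2)%N by rewrite (leq_double 1).
  have zk := zle 2 k2.
  suff : alpha^-1 <= 1 - (alpha ^+ 2)^-1 by lra.
  rewrite -(@ler_pM2r R (alpha ^+ 2)) ?exprn_gt0 //.
  rewrite mulrBl mulVf ?expf_neq0 ?gt_eqF // expr2 mulrA mulVf ?gt_eqF //.
  by rewrite -expr2; lra.
have aV0 : 0 < alpha^-1 by rewrite invr_gt0.
have epsN : 36 * N%:R ^+ 2 * eps <= 1.
  by rewrite -[X in _ <= X](@divff R (alpha ^+ N)) ?gt_eqF // ler_wpM2r // ltW.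
set g := (12 * N%:R ^+ 2 : R)^-1.
have NR : 16 <= N%:R :> R by rewrite ler_nat.
have N2 : 0 < N%:R ^+ 2 :> R by rewrite exprn_gt0 // ltr0n.
have gE : 12 * N%:R ^+ 2 * g = 1.
  by rewrite divff // gt_eqF // mulr_gt0.
have g0 : 0 < g by rewrite invr_gt0 mulr_gt0.
have N36 : 0 < 36 * N%:R ^+ 2 :> R by lra.
(* Since [36 = 3 * 12], the error [eps] is at most a third of the relative gap [g] given by
   [root2_pow_gap]. *)
have epsg : eps <= g / 3.
  rewrite -(@ler_pM2l R (36 * N%:R ^+ 2)) //.
  by apply: le_trans epsN _; lra.
have g1 : g <= 1 / 100 by nra.
have eps1 : eps <= 1 by lra.
have ee : eps ^+ 2 <= eps by rewrite expr2 ler_piMr // ltW.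
have e2 : 0 <= 1 + eps ^+ 2 by rewrite addr_ge0 // sqr_ge0.
have z1 : 0 <= 1 - z by lra.
rewrite !powRM ?powX ?bN ?(ltW aNp) ?(ltW akp) //.
rewrite -/u; set w := (1 - z) `^ p.
have w2 : (1 + eps ^+ 2) `^ p <= 1 + eps.
  by apply: le_trans (ler1_powR _ _) _; nra.
have w20 : 0 <= (1 + eps ^+ 2) `^ p by exact: powR_ge0.
suff key : (1 + eps) * (4 * (u - 1)) < u ^+ 2 * w.
  rewrite -(@ltr_pM2l R u); last lra.
  have un : u != 0 by rewrite gt_eqF // (lt_trans ltr01).
  set c := (1 + eps ^+ 2) `^ p in w2 w20 *.
  have -> : u * (2 * (2 * c) * (1 - u^-1)) = c * (4 * (u - 1)).
    by field.
  rewrite [ltRHS]mulrA -expr2; apply: le_lt_trans key.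
  by apply: ler_wpM2r => //; lra.
(* If [N < 2k], then [z <= eps <= g / 3], and [(1 + g) * (1 - g / 3) > 1 + g / 3] settles the
   case. *)
have [Nk|kN2] := ltnP N k.*2.
  have wz : 1 - z <= w.
    rewrite -{1}[1 - z]powRr1; last lra.
    by apply: ger_powR => //; lra.
  have zeps := zle _ (ltnW Nk); rewrite -/eps in zeps.
  have := root2_pow_gap _ _ _ b1 N0 bN k0 kN; rewrite -/u -/g.
  set U := 4 * (u - 1) => hU.
  have U0 : 0 < U by rewrite /U; lra.
  have h1 : (1 + g) * (1 - g / 3) * U <= u ^+ 2 * w.
    rewrite mulrAC; apply: ler_pM => //; rewrite ?mulr_ge0 //; lra.
  apply: lt_le_trans h1; rewrite ltr_pM2r //; nra.
(* Here [z] need not be tiny, but [u ^+ 2 <= b ^+ N = 2] keeps [u] away from 2. The crude bound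
   [w >= b^-1 >= 15/16], from [b <= 1 + 1/16], is then enough. *)
have u2 : u ^+ 2 <= 2 by rewrite -exprM muln2 -bN ler_eXn2l.
have u3 : u <= 3 / 2 by nra.
have bV : 15 / 16 <= b^-1.
  have := root2_sub1_ub _ _ b1 N0 bN.
  have : N%:R^-1 <= 16^-1 :> R by rewrite lef_pV2 ?posrE // ltr0n.
  by move=> h1 h2; rewrite -(ler_pM2r b0) mulVf ?gt_eqF //; lra.
have wb : 15 / 16 <= w.
  apply: le_trans bV _.
  rewrite /b -powR_inv_base //.
  by apply: ge0_ler_powR; rewrite ?nnegrE; lra.
have h : u ^+ 2 * (15 / 16) <= u ^+ 2 * w by rewrite ler_wpM2l // sqr_ge0.
apply: lt_le_trans h; nra.
Qed.

(** * Continuants of the metallic mean *)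

(** The index is shifted by one: [Q a k] is the denominator of index [k - 1], so that its
    approximation error is exactly [alpha ^- k] in absolute value. *)
Local Notation Q a k := (cf_rec (fun=> a) 1 0 k).2.
Local Notation P a k := (cf_rec (fun=> a) 0 1 k).2.

Lemma metallic_continuant_error (R : realType) (a k : nat) : (0 < a)%N ->
  let alpha := metallic_mean R a in
  (Q a k)%:R * alpha - (P a k)%:R = - (- alpha^-1) ^+ k.
Proof.
move=> a0 alpha; case: k => [|k]; first by rewrite /= expr0; ring.
exact: metallic_mean_error.
Qed.

(** Binet's formula: [alpha] and [- alpha^-1] are the two roots of [X^2 = a X + 1], so both sides
    obey the same recurrence with the same first two values. *)
Lemma metallic_continuant_den (R : realType) (a k : nat) : (0 < a)%N ->
  let alpha := metallic_mean R a in
  (Q a k)%:R * (alpha + alpha^-1) = alpha ^+ k - (- alpha^-1) ^+ k.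
Proof.
move=> a0 alpha; have m1 : 1 < alpha := metallic_mean_gt1 R a0.
have m0 : alpha != 0 by lra.
have m2 : alpha ^+ 2 = a%:R * alpha + 1 := metallic_mean_sqr R a.
have mV : alpha^-1 = alpha - a%:R.
  by apply: (mulfI m0); rewrite divff // mulrBr -expr2 m2; ring.
have QS j : Q a j.+2 = (a * Q a j.+1 + Q a j)%N by [].
suff [] : (Q a k)%:R * (alpha + alpha^-1) = alpha ^+ k - (- alpha^-1) ^+ k /\
  (Q a k.+1)%:R * (alpha + alpha^-1)
    = alpha ^+ k.+1 - (- alpha^-1) ^+ k.+1 by [].
elim: k => [|k [IH1 IH2]].
  by rewrite /= muln0 !expr0 !expr1; split; ring.
split=> //; rewrite QS natrD natrM mulrDl -mulrA IH1 IH2.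
have V2 : (- alpha^-1) ^+ 2 = a%:R * (- alpha^-1) + 1.
  by rewrite sqrrN expr2 {1}mV mulrBl divff //; ring.
rewrite -[k.+2]addn2 !exprD m2 V2 !exprS; ring.
Qed.

(** Passing from one pair of consecutive convergents to the next is a unimodular change of basis;
    solving the recurrence backwards gives the new coordinates. *)
Lemma metallic_continuant_lattice (a k : nat) (q r : int) : exists i j : int,
  q = i * (Q a k)%:Z + j * (Q a k.+1)%:Z /\
  r = i * (P a k)%:Z + j * (P a k.+1)%:Z.
Proof.
elim: k => [|k [i [j [-> ->]]]].
  by exists (r - a%:Z * q), q; rewrite /= muln0 muln1; split; lia.
exists (j - a%:Z * i), i.
have -> : (Q a k.+2)%:Z = a%:Z * (Q a k.+1)%:Z + (Q a k)%:Z by [].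
have -> : (P a k.+2)%:Z = a%:Z * (P a k.+1)%:Z + (P a k)%:Z by [].
by split; ring.
Qed.

Lemma metallic_continuant_ge (a k : nat) : (0 < a)%N -> (k <= Q a k.+1)%N.
Proof.
move=> a0.
suff [] : [/\ (k <= Q a k.+1)%N, (k < Q a k.+2)%N & (0 < Q a k.+1)%N] by [].
elim: k => [|k [IH1 IH2 IH3]]; first by rewrite /= !muln0 muln1 addn0.
have -> : Q a k.+3 = (a * Q a k.+2 + Q a k.+1)%N by [].
by split; nia.
Qed.

(** As [q] lies strictly between 0 and [B], the sign of [i * A = q - j * B] is determined by [j]. *)
Lemma opposite_coordinates (i j A B q : int) : 0 <= A -> 0 < q -> q < B ->
  q = i * A + j * B ->
  [/\ j < 0 -> 1 <= i, 0 < j -> i <= -1 & j = 0 -> i != 0].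
Proof. by move=> A0 q0 qB qE; split=> ? ; [nia|nia|apply/eqP; nia]. Qed.

(* In the basis of two consecutive convergents the coordinates of a point with
   [0 < q < Q (k+1)] have opposite signs, while the errors of the two
   convergents alternate, so the two contributions add up. *)
Lemma metallic_best_approx (R : realType) (a : nat) (q r : int) :
  (0 < a)%N -> 0 < q ->
  let alpha := metallic_mean R a in
  exists k : nat, [/\ (0 < k)%N, (Q a k)%:Z <= q &
    (alpha ^+ k)^-1 <= `|q%:~R * alpha - r%:~R|].
Proof.
move=> a0 q0 alpha; have m1 : 1 < alpha := metallic_mean_gt1 R a0.
have ex : exists k, (`|q|%N < Q a k.+1)%N.
  by exists `|q|%N.+1; exact: (leq_trans _ (metallic_continuant_ge _ _ a0)).
case: (ex_minnP ex) => k hk kmin; exists k.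
have Qk : (Q a k <= `|q|)%N.
  case: k hk kmin => [|k] hk kmin //.
  by rewrite leqNgt; apply/negP => /kmin; rewrite ltnn.
have k0 : (0 < k)%N.
  rewrite lt0n; apply/eqP => k0; move: hk.
  by rewrite k0 /= muln0 ltnS leqn0 absz_eq0 gt_eqF.
have qabs : `|q|%N%:Z = q by rewrite gez0_abs // ltW.
split=> //; first by rewrite -qabs lez_nat.
have [i [j [qE rE]]] := metallic_continuant_lattice a k q r.
have -> : q%:~R * alpha - r%:~R =
    - (- alpha^-1) ^+ k * (i%:~R - j%:~R * alpha^-1).
  transitivity (i%:~R * ((Q a k)%:R * alpha - (P a k)%:R)
              + j%:~R * ((Q a k.+1)%:R * alpha - (P a k.+1)%:R)).
    by rewrite qE rE !intrD !intrM !pmulrn; ring.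
  by rewrite !metallic_continuant_error // exprS; ring.
have alpha0 : 0 < alpha := lt_trans ltr01 m1.
have aV : 0 < alpha^-1 by rewrite invr_gt0.
rewrite normrM normrN normrX normrN (ger0_norm (ltW aV)) exprVn.
rewrite ler_peMr ?invr_ge0 ?exprn_ge0 ?(ltW alpha0) //.
have qB : q < (Q a k.+1)%:Z by rewrite -qabs ltz_nat.
have [j_lt0 j_gt0 j_eq0] :=
  opposite_coordinates _ _ _ _ _ (lez_nat 0 _) q0 qB qE.
have [j0|j0|j0] := ltrgtP j 0.
- have i1R : 1 <= i%:~R :> R by rewrite ler1z j_lt0.
  have j0R : j%:~R < 0 :> R by rewrite ltrz0.
  by apply: le_trans (ler_norm _); nra.
- have i1R : i%:~R <= (-1)%:~R :> R by rewrite ler_int j_gt0.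
  have j0R : 0 < j%:~R :> R by rewrite ltr0z.
  by rewrite -normrN; apply: le_trans (ler_norm _); nra.
- rewrite [in j%:~R]j0 mul0r subr0 -intr_norm ler1z.
  by rewrite -gtz0_ge1 normr_gt0 j_eq0.
Qed.

(** * The lattice and the first point of the p-continued fraction *)

Lemma latticeP {R : realType} (alpha x y : R) :
  lattice alpha (x, y) <->
  exists q r : int, x = q%:~R /\ y = r%:~R - q%:~R * alpha.
Proof.
have E (r q : int) : (0, 1) *~ r + (1, - alpha) *~ q =
    (q%:~R, r%:~R - q%:~R * alpha) :> R * R.
  have fstz (u : R * R) (n : int) : (u *~ n).1 = u.1 *~ n.
    exact: (raddfMz (@fst R R)).
  have sndz (u : R * R) (n : int) : (u *~ n).2 = u.2 *~ n.
    exact: (raddfMz (@snd R R)).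
  apply: injective_projections; first by rewrite /= fstz fstz /= mul0rz add0r.
  by rewrite /= sndz sndz /= mulNrz -[alpha *~ q]mulrzl.
split=> [[r [q]]|[q [r [-> ->]]]].
  by rewrite E => -[-> ->]; exists q, r.
by exists r, q; rewrite E.
Qed.

(** Taking the common factor [c = u^(-p)] out of the p-th powers leaves [u] only as [u^(2p)], so
    comparing with [(0, 1)] becomes linear in [u^(2p)]. *)
Lemma Ft_axisE {R : realType} (p u x y : R) : 0 < p -> 0 < u ->
  exists c : R,
  [/\ 0 < c, Ft p u (0, 1) = (c * (u `^ p) ^+ 2) `^ p^-1 &
      Ft p u (x, y) = (c * (`|x| `^ p + (u `^ p) ^+ 2 * `|y| `^ p)) `^ p^-1].
Proof.
move=> p0 u0; have up : 0 < u `^ p by exact: powR_gt0.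
exists (u `^ p)^-1; split; first by rewrite invr_gt0.
  rewrite /Ft /F /= mulr0 mulr1 normr0 powR0 ?gt_eqF // add0r gtr0_norm //.
  by congr powR; field; rewrite gt_eqF.
rewrite /Ft /F /= !normrM normfV (gtr0_norm u0).
have uV : 0 <= u^-1 by rewrite invr_ge0 ltW.
rewrite (powRM p uV (normr_ge0 x)) (powRM p (ltW u0) (normr_ge0 y)).
rewrite powR_inv_base //.
by congr powR; field; rewrite gt_eqF.
Qed.

Lemma Ft_axis_lt {R : realType} (p u x y : R) : 0 < p -> 0 < u ->
  Ft p u (x, y) < Ft p u (0, 1) <->
  `|x| `^ p < (u `^ p) ^+ 2 * (1 - `|y| `^ p).
Proof.
move=> p0 u0; have [c [c0 -> ->]] := Ft_axisE p u x y p0 u0.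
have pV : 0 < p^-1 by rewrite invr_gt0.
have u2 := sqr_ge0 (u `^ p); have xp := powR_ge0 `|x| p.
have yp := mulr_ge0 u2 (powR_ge0 `|y| p).
rewrite mulrBr mulr1 ltrBrDr -(ltr_pM2l c0 (_ + _)).
split=> [h|]; last first.
  by apply: gt0_ltr_powR; rewrite // nnegrE mulr_ge0 ?addr_ge0 ?(ltW c0).
rewrite ltNge; apply/negP => h'; move: h; rewrite ltNge => /negP; apply.
by apply: ge0_ler_powR;
  rewrite ?nnegrE ?mulr_ge0 ?addr_ge0 ?powR_ge0 ?(ltW c0) ?(ltW pV).
Qed.

Lemma Ft_axis_eq {R : realType} (p u x y : R) : 0 < p -> 0 < u ->
  Ft p u (x, y) = Ft p u (0, 1) <->
  `|x| `^ p = (u `^ p) ^+ 2 * (1 - `|y| `^ p).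
Proof.
move=> p0 u0; have [c [c0 -> ->]] := Ft_axisE p u x y p0 u0.
have pV : 0 < p^-1 by rewrite invr_gt0.
have u2 := sqr_ge0 (u `^ p); have xp := powR_ge0 `|x| p.
have yp := mulr_ge0 u2 (powR_ge0 `|y| p).
rewrite mulrBr mulr1; split=> [|->]; last by rewrite subrK.
move=> /(powR_injective pV).
rewrite !nnegrE !mulr_ge0 ?addr_ge0 ?powR_ge0 ?(ltW c0) //.
by move=> /(_ isT isT) /(mulfI (lt0r_neq0 c0)) h; rewrite -{1}h addrK.
Qed.

(* The ball [Bt p t (0, 1)] meets [(x, y)] as soon as
   [t^(2p) (1 - |y|^p) > |x|^p], so [C = t_0^(2p)] is the minimum of
   [|x|^p / (1 - |y|^p)] over the lattice. *)
Lemma pcf_point0 {R : realType} (p alpha C s y0 : R) :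
  0 < p -> 1 <= C -> 0 < s ->
  lattice alpha (s, y0) -> s `^ p = C * (1 - `|y0| `^ p) ->
  (forall x y, lattice alpha (x, y) -> (x, y) <> 0 ->
     C * (1 - `|y| `^ p) <= `|x| `^ p) ->
  (forall x y, lattice alpha (x, y) -> `|x| `^ p = C * (1 - `|y| `^ p) ->
     (x, y) <> (s, y0) -> x < s) ->
  pcf_point p alpha 0 = (s, y0).
Proof.
move=> p0 C1 s0 Ls sE Cmin Cright.
have C0 : 0 < C by exact: lt_le_trans C1.
have sp : 0 < s `^ p by exact: powR_gt0.
have y1 : 0 < 1 - `|y0| `^ p by rewrite -(pmulr_rgt0 _ C0) -sE.
(* [t0] solves [t^(2p) = C]; the hypothesis [1 <= C] puts it no earlier than the starting time 1. *)
pose t0 := C `^ (2 * p)^-1.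
have t0E : (t0 `^ p) ^+ 2 = C.
  rewrite -powR_mulrn ?powR_ge0 // -!powRrM.
  have -> : (2 * p)^-1 * (p * 2) = 1 by field; rewrite gt_eqF.
  by rewrite powRr1 // ltW.
have t0_gt0 : 0 < t0 by exact: powR_gt0.
have t01 : 1 <= t0 by apply: powR_ge1; rewrite ?invr_ge0 ?mulr_ge0 ?(ltW p0).
have tT : next_t p alpha (0, 1) 1 = t0.
  have t0A : is_largest (adm_times p alpha (0, 1) 1) t0.
    split.
      split=> // u /andP[u1 ut]; have u0 : 0 < u by exact: lt_le_trans u1.
      apply/seteqP; split=> [[x y]|_ ->].
        move=> [Lxy /(Ft_axis_lt _ _ _ _ p0 u0) lt_xy].
        apply: contrapT => /= xy0; move: lt_xy; rewrite ltNge => /negP; apply.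
        have [y_ge1|y_lt1] := leP 1 (`|y| `^ p).
          apply: le_trans (powR_ge0 _ _).
          by rewrite mulr_ge0_le0 ?sqr_ge0 // subr_le0.
        apply: le_trans (Cmin x y Lxy xy0).
        rewrite ler_wpM2r ?subr_ge0 ?(ltW y_lt1) // -t0E.
        rewrite lerXn2r ?nnegrE ?powR_ge0 //.
        by apply: ge0_ler_powR; rewrite ?nnegrE // ltW.
      split; first by apply/latticeP; exists 0, 0; rewrite mul0r subr0.
      apply/(Ft_axis_lt _ _ _ _ p0 u0).
      rewrite normr0 powR0 ?gt_eqF // subr0 mulr1 exprn_gt0 //.
      exact: powR_gt0.
    move=> T [T1 Tadm]; rewrite leNgt; apply/negP => tT.
    have T0 : 0 < T by exact: lt_le_trans T1.
    (* Past [t0] the ball contains [(s, y0)], which is not the origin because [s > 0]. *)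
    have : (lattice alpha `&` Bt p T (0, 1))%classic (s, y0).
      split=> //; apply/(Ft_axis_lt _ _ _ _ p0 T0).
      rewrite gtr0_norm // sE ltr_pM2r // -t0E ltrXn2r ?nnegrE ?powR_ge0 //.
      by apply: gt0_ltr_powR; rewrite ?nnegrE // ltW.
    rewrite Tadm ?T1 ?lexx // => -[s0' _].
    by rewrite s0' ltxx in s0.
  apply: xget_unique => // T [TA TM]; apply/eqP; rewrite eq_le.
  by rewrite (proj2 t0A _ TA) (TM _ (proj1 t0A)).
rewrite /pcf_point /= tT.
have right : is_rightmost (level_points p alpha (0, 1) t0) (s, y0).
  split.
    split; first exact: Ls.
    apply/(Ft_axis_eq _ _ _ _ p0 t0_gt0).
    by rewrite (gtr0_norm s0) t0E.
  move=> [x y] [Lxy /(Ft_axis_eq _ _ _ _ p0 t0_gt0)]; rewrite t0E => xE.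
  exact: Cright.
apply: xget_unique => // -[x y] [Exy Mxy]; apply: contrapT => xy.
have h1 := proj2 right _ Exy xy.
have h2 := Mxy _ (proj1 right) (nesym xy).
by have := lt_trans h1 h2; rewrite ltxx.
Qed.

(** * Minimality at the chosen convergent, and the theorem *)

(** [C] is the level of the N-th continuant pair, whose error has p-th power 1/2. Best approximation
    compares [(q, r)] with some index [k]: for [k <> N] the gap estimate is strict, and for [k = N]
    equality determines first [q], then the error, then [r]. *)
Lemma metallic_level_min {R : realType} (a N : nat) (p : R) (q r : int) :
  let alpha := metallic_mean R a in
  let C := 2 * (Q a N)%:R `^ p in
  (0 < a)%N -> 0 < p <= 1 -> (alpha `^ p) ^+ N = 2 -> (16 <= N)%N ->
  36 * N%:R ^+ 2 < alpha ^+ N -> 0 < q ->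
  C * (1 - `|r%:~R - q%:~R * alpha| `^ p) <= q%:~R `^ p /\
  (q%:~R `^ p = C * (1 - `|r%:~R - q%:~R * alpha| `^ p) ->
   q = (Q a N)%:Z /\ r = (P a N)%:Z).
Proof.
move=> alpha C a0 p01 bN N16 aN q0.
have p0 : 0 < p by case/andP: p01.
have m1 : 1 < alpha := metallic_mean_gt1 R a0.
have m0 : 0 < alpha := lt_trans ltr01 m1.
have m2 : alpha ^+ 2 = a%:R * alpha + 1 := metallic_mean_sqr R a.
have m3 : alpha + 1 <= alpha ^+ 2.
  by rewrite m2 lerD2r ler_peMl ?ler1n ?(ltW m0).
have C0 : 0 <= C by rewrite mulr_ge0 ?powR_ge0.
have qR : 0 < q%:~R :> R by rewrite ltr0z.
have powX k : (alpha ^+ k) `^ p = (alpha `^ p) ^+ k.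
  by rewrite -[alpha ^+ k]powR_mulrn ?(ltW m0) // powRAC powR_mulrn // powR_ge0.
have [k [k0 Qk]] := metallic_best_approx R a q r a0 q0.
rewrite -/alpha distrC; set y := `|_| => ky.
have akp : 0 < alpha ^+ k by exact: exprn_gt0.
have QkR : (Q a k)%:R <= q%:~R :> R by rewrite pmulrn ler_int.
have qQ : (Q a k)%:R `^ p <= q%:~R `^ p.
  by apply: ge0_ler_powR; rewrite ?nnegrE ?ler0n ?(ltW p0) ?(ltW qR).
have yk : ((alpha ^+ k) `^ p)^-1 <= y `^ p.
  rewrite -powR_inv_base //.
  by apply: ge0_ler_powR;
    rewrite ?nnegrE ?normr_ge0 ?invr_ge0 ?(ltW p0) ?(ltW akp).
have Cy : C * (1 - y `^ p) <= C * (1 - ((alpha ^+ k) `^ p)^-1).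
  by rewrite ler_wpM2l // lerD2l lerN2.
have [kN|/eqP kN] := eqVneq k N; last first.
  suff CQ : C * (1 - ((alpha ^+ k) `^ p)^-1) < (Q a k)%:R `^ p.
    have lt_Cq := lt_le_trans (le_lt_trans Cy CQ) qQ.
    by split=> [|qC]; [exact: ltW | rewrite -qC ltxx in lt_Cq].
  have gap := power_sum_gap alpha p N k m1 m3 p01 bN N16 aN k0 kN.
  have D0 : 0 < alpha + alpha^-1 by rewrite addr_gt0 ?invr_gt0.
  have Dp : 0 < (alpha + alpha^-1) `^ p by exact: powR_gt0.
  have signed j : - (alpha ^+ j)^-1 <= (- alpha^-1) ^+ j <= (alpha ^+ j)^-1.
    rewrite -ler_norml normrX normrN gtr0_norm ?invr_gt0 // exprVn.
    exact: lexx.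
  have denE j :
      (Q a j)%:R * (alpha + alpha^-1) = alpha ^+ j - (- alpha^-1) ^+ j.
    exact: metallic_continuant_den.
  have ak1 : (alpha ^+ k)^-1 <= alpha ^+ k.
    have h : 1 <= alpha ^+ k by rewrite exprn_ege1 // ltW.
    by apply: (le_trans _ h); rewrite invf_le1.
  have low : (alpha ^+ k - (alpha ^+ k)^-1) `^ p
      <= (Q a k)%:R `^ p * (alpha + alpha^-1) `^ p.
    rewrite -powRM ?ler0n ?(ltW D0) // denE.
    have h : alpha ^+ k - (alpha ^+ k)^-1 <= alpha ^+ k - (- alpha^-1) ^+ k.
      by rewrite lerD2l lerN2; case/andP: (signed k).
    apply: ge0_ler_powR; rewrite ?nnegrE ?(ltW p0) ?subr_ge0 //.
    by rewrite -subr_ge0; apply: le_trans h; rewrite subr_ge0.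
  have up : (Q a N)%:R `^ p * (alpha + alpha^-1) `^ p
      <= (alpha ^+ N + (alpha ^+ N)^-1) `^ p.
    rewrite -powRM ?ler0n ?(ltW D0) //.
    have h : (Q a N)%:R * (alpha + alpha^-1) <= alpha ^+ N + (alpha ^+ N)^-1.
      by rewrite denE lerD2l lerNl; case/andP: (signed N).
    have h0 : 0 <= (Q a N)%:R * (alpha + alpha^-1).
      by rewrite mulr_ge0 ?ler0n ?(ltW D0).
    by apply: ge0_ler_powR; rewrite ?nnegrE ?(ltW p0) ?(le_trans h0 h).
  rewrite -(ltr_pM2r Dp); apply: le_lt_trans (lt_le_trans gap low).
  rewrite /C mulrAC ler_wpM2r //.
    rewrite subr_ge0 invf_le1 ?powR_gt0 // powX exprn_ege1 //.
    by apply: powR_ge1; exact: ltW.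
  by rewrite -mulrA ler_wpM2l.
rewrite {}kN in k0 Qk ky akp QkR qQ yk Cy.
have CN : C * (1 - ((alpha ^+ N) `^ p)^-1) = (Q a N)%:R `^ p.
  by rewrite powX bN /C; field.
rewrite CN in Cy; split=> [|qC]; first exact: le_trans Cy qQ.
have qN : q = (Q a N)%:Z.
  have /(powR_injective p0) : q%:~R `^ p = (Q a N)%:R `^ p.
    by apply/le_anti; rewrite qQ {1}qC Cy.
  rewrite !nnegrE ler0n (ltW qR) => /(_ isT isT) qE.
  by apply: (@mulrIz R 1 (oner_neq0 R)) => /=; rewrite qE pmulrn.
split=> //.
have QN0 : 0 < (Q a N)%:R `^ p :> R by rewrite pmulrn -qN powR_gt0.
have yN : y = (alpha ^+ N)^-1.
  have /(powR_injective p0) : y `^ p = (alpha ^+ N)^-1 `^ p.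
    rewrite powR_inv_base // powX bN.
    have : (Q a N)%:R `^ p * (2 * y `^ p - 1) = 0 :> R.
      by move: qC; rewrite qN -pmulrn /C; lra.
    by move=> /eqP; rewrite mulf_eq0 gt_eqF //= => /eqP; lra.
  by rewrite !nnegrE normr_ge0 invr_ge0 (ltW akp) => /(_ isT isT).
have errN : `|(Q a N)%:R * alpha - (P a N)%:R| = (alpha ^+ N)^-1.
  rewrite metallic_continuant_error // normrN normrX normrN normfV.
  by rewrite gtr0_norm // exprVn.
(* Both [r] and [P a N] lie within [alpha ^- N < 1/2] of [q * alpha], so these integers coincide. *)
have small : (alpha ^+ N)^-1 < 2^-1.
  rewrite ltf_pV2 ?posrE //; apply: le_lt_trans aN.
  have : 16 <= N%:R :> R by rewrite ler_nat.
  by nra.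
have rP : `|r%:~R - (P a N)%:Z%:~R| < 1 :> R.
  have -> : r%:~R - (P a N)%:Z%:~R =
      ((Q a N)%:R * alpha - (P a N)%:R) - (q%:~R * alpha - r%:~R) :> R.
    by rewrite qN !pmulrn; ring.
  apply: le_lt_trans (ler_normB _ _) _.
  by rewrite errN [X in _ + X]distrC -/y yN; lra.
apply/eqP; rewrite -subr_eq0 -normr_eq0 -normr_le0.
by move: rP; rewrite -intrB -intr_norm ltrz1.
Qed.

Theorem theorem1p3 (R : realType) (a : nat) (ha : (1 <= a)%N) :
  exists M : nat, forall m : nat, (0 < m)%N -> (M <= m)%N ->
    exists p : R, 0 < p < 1 /\
      p_convergent p (metallic_mean R a) 0 = convergent R (fun=> a) m.
Proof.
set alpha := metallic_mean R a.
have m1 : 1 < alpha := metallic_mean_gt1 R ha.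
have m0 : 0 < alpha := lt_trans ltr01 m1.
have l0 : 0 < ln alpha by exact: ln_gt0.
pose B := 36 * 6 / ln alpha ^+ 3.
have B0 : 0 <= B by rewrite divr_ge0 ?mulr_ge0 ?exprn_ge0 ?(ltW l0).
(* [B] is the threshold of [cubic_exp_bound] for the constant 36, and 16 is the lower bound on [N]
   in the gap estimate. The shifted index makes [N = m + 1]. *)
exists (Num.Def.archi_bound B + 16)%N => m _ Mm; pose N := m.+1.
have N16 : (16 <= N)%N.
  by apply: leq_trans (leqW Mm); exact: leq_addl.
have aN : 36 * N%:R ^+ 2 < alpha ^+ N.
  apply: cubic_exp_bound => //; apply: lt_le_trans (archi_boundP B0) _.
  by rewrite ler_nat; apply: leq_trans (leqW Mm); exact: leq_addr.
have aNp : 0 < alpha ^+ N by exact: exprn_gt0.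
have aN2 : 2 < alpha ^+ N.
  apply: le_lt_trans aN; have : 16 <= N%:R :> R by rewrite ler_nat.
  by nra.
have l2 : 0 < ln 2 :> R by apply: ln_gt0; rewrite ltr1n.
have lN : 0 < ln (alpha ^+ N).
  by apply: ln_gt0; apply: lt_trans aN2; rewrite ltr1n.
(* The solution of [alpha^(N p) = 2]; it is below 1 because [alpha ^+ N > 2]. *)
pose p := ln 2 / ln (alpha ^+ N).
have p0 : 0 < p by exact: divr_gt0.
have p1 : p < 1 by rewrite ltr_pdivrMr // mul1r ltr_ln ?posrE.
have bN : (alpha `^ p) ^+ N = 2.
  rewrite -powR_mulrn ?powR_ge0 // powRAC powR_mulrn ?(ltW m0) //.
  rewrite /powR gt_eqF // /p divfK ?gt_eqF // lnK // posrE.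
  exact: ltr0n.
exists p; split; first by rewrite p0.
have p01 : 0 < p <= 1 by rewrite p0 ltW.
have lvl q r := @metallic_level_min R a N p q r ha p01 bN N16 aN.
have QN : (0 < Q a N)%N.
  apply: (leq_trans _ (metallic_continuant_ge a m ha)).
  by rewrite -ltnS (leq_trans _ N16).
have QNR : 0 < (Q a N)%:R :> R by rewrite ltr0n.
pose s := (Q a N)%:R : R; pose y0 := (P a N)%:R - s * alpha.
have y0E : `|y0| `^ p = 2^-1.
  rewrite distrC /s metallic_continuant_error // normrN normrX normrN normfV.
  rewrite gtr0_norm // exprVn powR_inv_base //.
  rewrite -[alpha ^+ N]powR_mulrn ?(ltW m0) //.
  by rewrite powRAC powR_mulrn ?powR_ge0 // bN.
have -> : p_convergent p alpha 0 = (y0 + s * alpha) / s.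
  suff E : pcf_point p alpha 0 = (s, y0).
    by rewrite /p_convergent /pcf_r /pcf_s E.
  apply: (@pcf_point0 R p alpha (2 * s `^ p)) => //.
  - have : 1 <= s `^ p.
      by rewrite powR_ge1 ?ler1n ?(ltW p0).
    by lra.
  - by apply/latticeP; exists (Q a N)%:Z, (P a N)%:Z.
  - by rewrite y0E; field.
  - move=> x y /latticeP[q [r [-> ->]]] qr0.
    (* Reflection through the origin reduces [q < 0] to [q > 0]. If [q = 0], then [|r| >= 1] makes
       the left side nonpositive. *)
    have [q0|q0|q0] := ltrgtP q 0.
    + have qN : 0 < - q by rewrite oppr_gt0.
      have [+ _] := lvl _ (- r) qN.
      rewrite !mulrNz mulNr -opprD normrN -/alpha -/s.
      by rewrite [`|q%:~R|]ltr0_norm // ltrz0.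
    + have [+ _] := lvl q r q0.
      by rewrite [`|q%:~R|]gtr0_norm // ltr0z.
    + rewrite q0 mul0r subr0 normr0 [X in _ <= X]powR0 ?gt_eqF //.
      rewrite mulr_ge0_le0 ?mulr_ge0 ?powR_ge0 // subr_le0.
      apply: powR_ge1; first exact: ltW.
      rewrite norm_intr_ge1 ?intr_int // intr_eq0; apply/eqP => r0.
      by apply: qr0; rewrite q0 r0 mul0r subr0.
  - move=> x y /latticeP[q [r [-> ->]]] qE qr.
    have [q0|q0] := lerP q 0.
      by apply: le_lt_trans QNR; rewrite lerz0.
    have [_ lvlE] := lvl q r q0.
    rewrite gtr0_norm ?ltr0z // in qE.
    have [qN rN] := lvlE qE.
    by case: qr; rewrite qN rN.
by rewrite /y0 subrK /convergent.
Qed.
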